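(* Let $\mathcal{J}=f+g$ be a sum of two convex, coercive, lower semi-continuous functions on $E$ that are bounded from below, where $f:E\to\mathbb{R}$ is differentiable with $L$-Lipschitz gradient ($L>0$) and $g:E\to\mathbb{R}\cup\{+\infty\}$ is proper. Let $0<\gamma<\frac{2}{L}$ and $x_0\in E$, and let $(x_n)_{n\in\mathbb{N}}$ be defined for all $n\in\mathbb{N}$ by $$x_{n+1}=\operatorname{prox}_{\gamma g}\bigl(x_n-\gamma\nabla f(x_n)\bigr).$$ Then the sequence $(x_n)_{n\in\mathbb{N}}$ converges to a minimizer of $\mathcal{J}$.
   Context: $E$ is a finite-dimensional Euclidean space with inner product $\langle\cdot,\cdot\rangle$ and associated norm $\|\cdot\|$. A function is coercive if it tends to $+\infty$ as $\|x\|\to+\infty$; it is proper if it never takes the value $-\infty$ and is finite at some point. For a proper convex lower semi-continuous function $g$ and $\gamma>0$, $\operatorname{prox}_{\gamma g}(x)=\arg\min_{z\in E}\gamma g(z)+\frac12\|x-z\|^2$ (a unique minimizer). *)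

(* Defs.v *)
From HB Require Import structures.
From mathcomp Require Import all_boot all_order all_algebra sesquilinear.
From mathcomp Require Import all_classical all_reals all_analysis.

Set Implicit Arguments.
Unset Strict Implicit.
Unset Printing Implicit Defensive.

Import Order.TTheory GRing.Theory Num.Theory.
Import numFieldNormedType.Exports.

Local Open Scope classical_set_scope.
Local Open Scope ring_scope.

(* Finite-dimensional normed spaces: the topology is that of the norm, the     *)
(* dimension is that of the Vector structure.                                  *)
#[short(type="normedVectType")]
HB.structure Definition NormedVector (R : numFieldType) :=
  {E of NormedModule R E & Vector R E}.

Section extended_functions.
Context {R : realType} {E : normedVectType R}.
Implicit Types h : E -> \bar R.

Definition eproper h := (forall x, h x != -oo%E) /\ (exists x, h x \is a fin_num).

(* Only meaningful for h without value -oo; as 0 * +oo = 0, the endpoints      *)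
(* t = 0 and t = 1 impose nothing.                                             *)
Definition econvex h := forall (t : R) (x y : E), 0 <= t <= 1 ->
  (h (t *: x + (1 - t) *: y)%R <= t%:E * h x + (1 - t)%:E * h y)%E.

Definition norm_pinfty : set_system E :=
  filter_from [set: R] (fun M => [set x : E | M < `|x|]).

Global Instance norm_pinfty_filter : Filter norm_pinfty.
Proof.
apply: filter_from_filter; first by exists 0.
move=> M N _ _; exists (Num.max M N) => // x /=.
by rewrite gt_max => /andP[].
Qed.

Definition coercive h := h x @[x --> norm_pinfty] --> +oo%E.

Definition bounded_below h := exists m : R, forall x, (m%:E <= h x)%E.

Definition minimizers h : set E := [set z | forall w, (h z <= h w)%E].

(* The default value 0 is irrelevant when g is proper, convex and lower        *)
(* semicontinuous and gamma > 0: the set is then a singleton.                  *)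
Definition prox (gamma : R) (g : E -> \bar R) (x : E) : E :=
  xget 0 (minimizers
    (fun z => gamma%:E * g z + (2^-1 * `|x - z| ^+ 2)%:E)%E).

End extended_functions.

Section gradient.
Context {R : realType} {E : normedVectType R}.

Lemma riesz (ip : {dot E for idfun}) (phi : {linear E -> R}) :
  exists v, forall u, phi u = ip v u.
Proof.
set b := vbasis {:E}.
pose G := \matrix_(i, j) ip (b`_i) (b`_j) : 'M[R]_(\dim {:E}).
have bb : basis_of {:E} b by exact: vbasisP.
have Gf : G \in unitmx.
  rewrite -row_free_unit -kermx_eq0; apply/rowV0P => c /sub_kermxP cG.
  pose v := \sum_i c ord0 i *: b`_i.
  have vb j : (j < \dim {:E})%N -> ip v (b`_j) = 0.
    move=> jn; have := congr1 (fun M => fun_of_matrix M 0 (Ordinal jn)) cG.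
    rewrite !mxE => <-; rewrite /v linear_sumlz /=; apply: eq_bigr => i _.
    by rewrite linearZl_LR !mxE.
  have v0 : v = 0.
    apply/eqP; apply: contraT => vn0.
    have : 0 < ip v v by apply: neq0_dnorm_gt0.
    rewrite {2}/v linear_sum /= big1 ?ltxx// => i _.
    by rewrite linearZr_LR /= vb// mulr0.
  apply/rowP => i; rewrite mxE.
  have /freeP := basis_free bb; exact.
pose c := (\row_j phi (b`_j)) *m invmx G.
exists (\sum_i c 0 i *: b`_i) => u.
rewrite (coord_basis bb (memvf u)) !linear_sum /=; apply: eq_bigr => j _.
rewrite linearZ linearZr_LR /=; congr (_ * _).
rewrite linear_sumlz /=.
have : c *m G = \row_j phi (b`_j) by rewrite mulmxKV.
move/(congr1 (fun M => fun_of_matrix M 0 j)); rewrite !mxE => <-.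
by apply: eq_bigr => i _; rewrite linearZl_LR !mxE.
Qed.

(* Riesz representative of the differential of f at x for the inner product ip *)
Definition grad (ip : {dot E for idfun}) (f : E -> R) (x : E) : E :=
  xget 0 [set v | forall u, 'd f x u = ip v u].

Lemma gradP (ip : {dot E for idfun}) (f : E -> R) (x : E) :
  forall u, 'd f x u = ip (grad ip f x) u.
Proof.
apply: (@xgetPex _ 0 [set v | forall u, 'd f x u = ip v u]).
exact: (riesz ip ('d f x)).
Qed.

End gradient.

(* Main.v *)
(* With p = x_(n+1), the variational inequality of the proximal point, the     *)
(* descent lemma and the gradient inequality for f give, for J z finite,       *)
(*   |p - z|^2 + 2 gamma (J p - J z)                                           *)
(*     <= |x_n - z|^2 + (gamma L - 1) |p - x_n|^2,                             *)
(* and z = x_n in the first two gives |p - x_n|^2 <= K (J x_n - J p) with      *)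
(* K = gamma / (1 - gamma L / 2).  As gamma L < 2, it follows that             *)
(*   |p - z|^2 + K J p + 2 gamma (J p - J z) <= |x_n - z|^2 + K J x_n.         *)
(* Telescoping forces lim J x_n <= J z for every z, so every cluster point is  *)
(* a minimizer; at such a z the quantity |x_n - z|^2 + K J x_n is              *)
(* nonincreasing, so the whole sequence converges to z.  As J x_0 may be       *)
(* infinite, all this is done from x_1 on.                                     *)
Require Import Defs.
From HB Require Import structures.
From mathcomp Require Import all_boot all_order all_algebra sesquilinear.
From mathcomp Require Import all_classical all_reals all_analysis.
From mathcomp Require Import ring lra.
Import Order.TTheory GRing.Theory Num.Theory.
Import numFieldNormedType.Exports.
Local Open Scope classical_set_scope.
Local Open Scope ring_scope.

(** The iteration is explicit in f and implicit in g. [prox_variational] says that (y - p) / gamma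
    is a subgradient of g at p = prox y; [grad_le] and [descent] bound f from below and above by its
    linearization at the current point, up to a quadratic error. Added together, they give an
    inequality whose error term is absorbed by the decrease of J exactly because gamma L < 2. What
    remains is a Fejér-type argument, isolated in [lyapunov_cvg]. Coercivity of g keeps the iterates
    bounded, [closed_norm_ball_compact] provides a cluster point, lower semicontinuity makes it a
    minimizer, and a nonincreasing quantity turns clustering into convergence. *)

Section euclidean.
Context {R : realType} {E : normedVectType R} (ip : {dot E for idfun}).
Context (norm_ip : forall u : E, `|u| = Num.sqrt (ip u u)).

(** * Euclidean identities, Cauchy-Schwarz and compact balls *)

Lemma ipC u v : ip u v = ip v u.
Proof. by rewrite hermC /= expr0 mul1r. Qed.

Lemma ipvv u : ip u u = `|u| ^+ 2.
Proof.
rewrite norm_ip sqr_sqrtr//.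
by have [->|/(neq0_dnorm_gt0 (s := ip))/ltW//] := eqVneq u 0; rewrite linear0r.
Qed.

Lemma sqr_normD u v : `|u + v| ^+ 2 = `|u| ^+ 2 + 2 * ip u v + `|v| ^+ 2.
Proof.
rewrite -!ipvv linearDl linearDr /= linearDr /= (ipC v u); ring.
Qed.

Lemma sqr_normB u v : `|u - v| ^+ 2 = `|u| ^+ 2 - 2 * ip u v + `|v| ^+ 2.
Proof. by rewrite sqr_normD normrN linearNr /=; ring. Qed.

(** Cauchy-Schwarz: expand the square of the norm of |v| u - |u| v, which is nonnegative, and divide
    by |u| |v|. *)
Lemma ip_le_norm u v : ip u v <= `|u| * `|v|.
Proof.
have [->|u0] := eqVneq u 0; first by rewrite linear0l normr0 mul0r.
have [->|v0] := eqVneq v 0; first by rewrite linear0r normr0 mulr0.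
have uv0 : 0 < `|u| * `|v| by rewrite mulr_gt0 ?normr_gt0.
have ipZ : ip (`|v| *: u) (`|u| *: v) = `|v| * (`|u| * ip u v).
  by rewrite linearZl_LR linearZr_LR.
have := sqr_ge0 `| `|v| *: u - `|u| *: v|.
rewrite sqr_normB // ipZ !normrZ !normr_id -(ler_pM2l uv0) => h; lra.
Qed.

Lemma normr_ip_le u v : `|ip u v| <= `|u| * `|v|.
Proof.
rewrite ler_norml ip_le_norm andbT.
by rewrite lerNl -[leLHS]linearNl /= -(normrN u) ip_le_norm.
Qed.

(* By Riesz the coordinates are bounded on the ball, which is therefore in the *)
(* continuous image of a cube.                                                 *)
Lemma closed_norm_ball_compact (r : R) : compact [set u : E | `|u| <= r].
Proof.
pose b := vbasis {:E}; pose n := \dim {:E}.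
have bb : basis_of {:E} b by exact: vbasisP.
pose A (M : R) : set 'rV[R]_n :=
  [set c : 'rV[R]_n | forall i, `[- M, M]%classic (c ord0 i)].
have cA M : compact (A M).
  by apply: (@rV_compact R n (fun=> `[- M, M]%classic)) => _; exact: segment_compact.
pose psi (c : 'rV[R]_n) : E := \sum_i c ord0 i *: b`_i.
have cpsi : continuous psi.
  rewrite (_ : psi = fun c => \sum_i c ord0 i *: b`_i)//.
  apply: continuous_big => [|i _]; first exact: add_continuous.
  move=> c; apply: (@cvgZr_tmp R E _ (nbhs c) _).
  exact: (@coord_continuous R 1 n ord0 i c).
have [M coordM] : exists M : R, forall i u, `|u| <= r -> `|coord b i u| <= M.
  have /choice[v vE] i : exists v, forall u, coord b i u = ip v u by exact: riesz.
  exists (\sum_i `|v i| * `|r|) => i u ur; rewrite vE (le_trans (normr_ip_le _ _))//.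
  rewrite (bigD1 i)//=; apply: ler_wpDr.
    by apply: sumr_ge0 => j _; rewrite mulr_ge0.
  by rewrite ler_wpM2l// (le_trans ur)// ler_norm.
apply: (@subclosed_compact _ _ (psi @` A M)).
- apply: (@preimage_closed _ _ (fun u : E => `|u|) [set x | x <= r]);
    last exact: closed_le.
  by move=> u _; exact: norm_continuous.
- by apply: continuous_compact => //; exact: continuous_subspaceT.
- move=> u /= ur; exists (\row_i coord b i u).
    by move=> i; rewrite /= mxE in_itv/= -ler_norml coordM.
  rewrite [RHS](coord_basis bb (memvf u)).
  by apply: eq_bigr => i _; rewrite mxE.
Qed.

End euclidean.

(** * Lower semicontinuity: cluster points and continuous perturbations *)

Section lower_semicontinuity.
Context {R : realType} {T : topologicalType}.
Implicit Types (h : T -> \bar R) (k : T -> R).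

(** Otherwise h > a on a neighbourhood of z, which must meet the set of F where h <= a. This is
    applied both to minimizing sequences and to the iterates. *)
Lemma lsc_cluster_le h (F : set_system T) (FF : Filter F) (a : R) z :
  lower_semicontinuous h -> (\forall y \near F, h y <= a%:E)%E -> cluster F z ->
  (h z <= a%:E)%E.
Proof.
move=> hlsc Fa Fz; rewrite leNgt; apply/negP => /hlsc[V zV Va].
have [y [/= ya Vy]] := Fz _ _ Fa zV.
by have := Va _ Vy; rewrite ltNge ya.
Qed.

Lemma lower_semicontinuousD_continuous h k (c : R) : 0 < c ->
  lower_semicontinuous h -> continuous k ->
  lower_semicontinuous (fun z => c%:E * h z + (k z)%:E)%E.
Proof.
move=> c0 hlsc kc z a az.
have [b bz ab] : exists2 b : R, (b%:E < h z)%E & a - c * b < k z.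
  case: (h z) az => [r| |].
  - rewrite -EFinM -EFinD !lte_fin => az.
    (* Lowering r by this amount lowers c r + k z by half of its excess over a; the other half is
       left for k. *)
    exists (r - (c * r + k z - a) / (2 * c)).
      by rewrite lte_fin ltrBlDr ltrDl divr_gt0 ?subr_gt0// mulr_gt0.
    suff -> : c * (r - (c * r + k z - a) / (2 * c)) =
      c * r - (c * r + k z - a) / 2 by lra.
    by field; rewrite gt_eqF.
  - move=> _; exists ((a - k z + 1) / c); first by rewrite ltry.
    by rewrite mulrC divfK ?gt_eqF//; lra.
  - by rewrite gt0_muleNy ?lte_fin//.
have [V zV Vb] := hlsc z b bz.
exists (V `&` [set y | a - c * b < k y]).
  by apply: filterI => //; exact: (@cvgr_gt _ _ _ _ k (k z) (kc z) _ ab).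
move=> y [/Vb]; case: (h y) => [r| |//] /= br ak.
- rewrite -EFinM -EFinD lte_fin; rewrite lte_fin in br.
  by have := ltr_pM2l c0 b r; rewrite br => cbr; lra.
- by rewrite gt0_muley ?lte_fin// addye ?ltry.
Qed.

End lower_semicontinuity.

(** * First-order inequalities for f *)

Section smooth.
Context {R : realType} {E : normedVectType R} (ip : {dot E for idfun}).
Context (norm_ip : forall u : E, `|u| = Num.sqrt (ip u u)).
Context (f : E -> R) (f_diff : forall u : E, differentiable f u).

(** The difference quotients of the restriction at t are literally those of f at t d + u in the
    direction d. *)
Lemma is_derive_line u d (t : R) :
  is_derive t 1 (fun s : R => f (s *: d + u)) (ip (grad ip f (t *: d + u)) d).
Proof.
rewrite -gradP -deriveE//.
have dfd : derivable f (t *: d + u) d by exact: diff_derivable.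
pose fl (s : R) := f (s *: d + u).
have E1 : (fun h : R => h^-1 *: ((fl \o shift t) (h *: 1) - f (t *: d + u)))
  = (fun h => h^-1 *: ((f \o shift (t *: d + u)) (h *: d) - f (t *: d + u))).
  apply/funext => h; rewrite /fl /=; congr (_ *: (f _ - _)).
  by rewrite [h *: 1]mulr1 scalerDl addrA.
by split; rewrite /derivable /derive E1.
Qed.

(** If it failed, the slopes (f (u + t d) - f u) / t, which tend to the directional derivative as t
    decreases to 0, would exceed f z - f u for small t; convexity bounds them by f z - f u. *)
Lemma grad_le : convex_function (E := E) setT f ->
  forall u z, f u + ip (grad ip f u) (z - u) <= f z.
Proof.
move=> fconv u z; rewrite leNgt; apply/negP => lt_fz.
pose d := z - u; pose D := ip (grad ip f u) d.
have fd : is_derive (0 : R) 1 (fun s : R => f (s *: d + u)) D.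
  by have := is_derive_line u d 0; rewrite scale0r add0r.
have /cvg_dnbhs_at_right cvD := @ex_derive _ _ _ _ _ _ _ fd.
rewrite -[lim _]/('D_1 (fun s : R => f (s *: d + u)) 0) derive_val in cvD.
have lt_D : f z - f u < D by rewrite /D/d; lra.
have nD := @cvgr_gt _ _ _ _ _ _ cvD _ lt_D.
near (0 : R)^'+ => t.
have t0 : 0 < t by near: t; exact: nbhs_right_gt.
have t1 : t < 1 by near: t; exact: nbhs_right_lt.
have : (fun s : R => f z - f u <
    s^-1 *: (((fun s : R => f (s *: d + u)) \o shift 0) s%:A - f (0 *: d + u))) t.
  by near: t; exact: nD.
rewrite /= [t%:A]mulr1 addr0 scale0r add0r.
rewrite [_ *: _]mulrC ltr_pdivlMr//.
have t01 : 0 <= t <= 1 by rewrite !ltW.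
have := fconv (Itv01 (andP t01).1 (andP t01).2) z u (mem_set I) (mem_set I).
rewrite convRE /= /unstable.onem.
have -> : conv (Itv01 (andP t01).1 (andP t01).2) (z : convex_lmodType E) u = t *: d + u.
  by rewrite /conv /= /unstable.onem scalerBr scalerBl scale1r addrA addrAC.
lra.
Unshelve. all: by end_near.
Qed.

(** The claim is phi 1 <= phi 0, where phi is f along the segment minus its linear part and s^2 L/2
    |d|^2. By the mean value theorem it suffices that phi' <= 0 inside the segment, which is the
    Lipschitz bound combined with Cauchy-Schwarz. *)
Lemma descent (L : R) : L.-lipschitz (grad ip f) ->
  forall u v, f v <= f u + ip (grad ip f u) (v - u) + L / 2 * `|v - u| ^+ 2.
Proof.
move=> flip u v; pose d := v - u; pose D := ip (grad ip f u) d.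
pose phi := (fun s : R => f (s *: d + u)) - (fun s => s * D)
  - (fun s => s ^+ 2 * (L / 2 * `|d| ^+ 2)).
pose dphi (t : R) := ip (grad ip f (t *: d + u)) d - D - t * (L * `|d| ^+ 2).
have dphiE (t : R) : is_derive t 1 phi (dphi t).
  have := is_derive_line u d t => ?.
  apply: is_derive_eq; rewrite /dphi /=.
  by rewrite /GRing.scale /=; field.
have cphi : {within `[0, 1], continuous phi}.
  by apply: derivable_within_continuous => t _; exact: ex_derive.
have [t] := MVT ltr01 (fun t _ => dphiE t) cphi.
rewrite in_itv /= => /andP[t0 t1].
suff : dphi t <= 0.
  rewrite /phi /= !fctE /= scale1r scale0r add0r subrK => + /esym.
  rewrite /D -/d; lra.
have : ip (grad ip f (t *: d + u) - grad ip f u) d <= L * (t * `|d|) * `|d|.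
  rewrite (le_trans (ip_le_norm ip norm_ip _ _))// ler_wpM2r//.
  have := flip (t *: d + u, u) (conj I I).
  by rewrite /= addrK normrZ ger0_norm// ltW.
rewrite linearBl /= -/D /dphi; lra.
Qed.

End smooth.

(** * The proximal point: existence and variational inequality *)

Lemma le0_of_forall_small (R : realType) (a b : R) : 0 <= b ->
  (forall t, 0 < t < 1 -> a <= t * b) -> a <= 0.
Proof.
move=> b0 ab; rewrite leNgt; apply/negP => a0.
have ab1 : 0 < a + b + 1 by lra.
(* The summand 1 keeps this t below 1 even when b = 0; the hypothesis at t then reads a (a + b + 1)
   <= a b. *)
have /ab : 0 < a / (a + b + 1) < 1 by rewrite divr_gt0//= ltr_pdivrMr//; lra.
by rewrite mulrAC ler_pdivlMr// => h; nra.
Qed.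

Lemma convex_combE (R : pzRingType) (E : lmodType R) (t : R) (z p : E) :
  t *: z + (1 - t) *: p = p + t *: (z - p).
Proof. by rewrite scalerBl scale1r scalerBr addrC addrAC addrA. Qed.

Section proximal.
Context {R : realType} {E : normedVectType R} (ip : {dot E for idfun}).
Context (norm_ip : forall u : E, `|u| = Num.sqrt (ip u u)).

Lemma compact_seq_cluster (u : nat -> E) (r : R) :
  (\forall n \near \oo, `|u n| <= r) -> exists z, cluster (u @ \oo) z.
Proof.
move=> ur; have [z [_ uz]] := closed_norm_ball_compact ip norm_ip r (u @ \oo) _ ur.
by exists z.
Qed.

(** The direct method: a minimizing sequence eventually lies in the bounded sublevel set {h < a}, so
    it has a cluster point, where h is at most its infimum. *)
Lemma minimizer_exists (h : E -> \bar R) (r a : R) (z0 : E) :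
  lower_semicontinuous h -> (h z0 < a%:E)%E -> bounded_below h ->
  (forall z, (h z < a%:E)%E -> `|z| <= r) -> exists z, minimizers h z.
Proof.
move=> hlsc z0a [m hm] hr.
have [|v vh v_inf] := ereal_inf_seq (S := range h).
  by apply/set0P; exists (h z0), z0.
have /choice[u uv] n : exists z, h z = v n by have [z _ hz] := vh n; exists z.
have inf_lt : (ereal_inf (range h) < a%:E)%E.
  by apply: le_lt_trans z0a; apply: ereal_inf_lbound; exists z0.
have inf_fin : ereal_inf (range h) \is a fin_num.
  rewrite fin_numElt (lt_trans inf_lt) ?ltry// andbT.
  by apply: (lt_le_trans (ltNyr m)); apply: le_ereal_inf_tmp => _ [z _ <-].
have [z uz] : exists z, cluster (u @ \oo) z.
  apply: (@compact_seq_cluster _ r).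
  have : \forall n \near \oo, (v n < a%:E)%E.
    exact: (v_inf _ (open_ereal_lt' inf_lt)).
  by apply: filterS => n; rewrite -uv; exact: hr.
exists z => w.
suff : (h z <= ereal_inf (range h))%E.
  by move/le_trans; apply; apply: ereal_inf_lbound; exists w.
rewrite -(fineK inf_fin); apply/lee_addgt0Pr => e e0.
rewrite -EFinD; apply: (lsc_cluster_le h (u @ \oo) _ _ z hlsc _ uz).
have : \forall n \near \oo, (v n < (fine (ereal_inf (range h)) + e)%:E)%E.
  apply: (v_inf _ (open_ereal_lt' _)).
  by rewrite -[ltLHS]fineK// lte_fin ltrDl.
by rewrite near_simpl; apply: filterS => n; rewrite -uv => /ltW.
Qed.

Context (gamma : R) (g : E -> \bar R).
Context (gamma_gt0 : 0 < gamma) (g_proper : eproper g) (g_convex : econvex g)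
  (g_lsc : lower_semicontinuous g) (g_bounded : bounded_below g).

Let prox_obj y z : \bar R := (gamma%:E * g z + (2^-1 * `|y - z| ^+ 2)%:E)%E.

Lemma prox_minimizer y : minimizers (prox_obj y) (prox gamma g y).
Proof.
apply: (@xgetPex _ 0 (minimizers (prox_obj y))).
have [m gm] := g_bounded; have [_ [z0 gz0]] := g_proper.
pose a := gamma * fine (g z0) + 2^-1 * `|y - z0| ^+ 2 + 1.
(* Where the objective is below [a], g >= m gives |y - z|^2 < 2 (a - gamma m); the radius then comes
   from |z| <= |y| + |y - z| and s <= s^2 + 1. *)
apply: (@minimizer_exists _ (`|y| + 2 * (a - gamma * m) + 1) a z0).
- apply: lower_semicontinuousD_continuous => // z.
  apply: cvgM; first exact: cvg_cst.
  apply: (@cvg_comp _ _ _ (fun z => `|y - z|) (fun x => x ^+ 2) _ (nbhs `|y - z|));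
    last exact: exprn_continuous.
  by apply: cvg_norm; apply: cvgB; [exact: cvg_cst|exact: cvg_id].
- by rewrite /prox_obj -(fineK gz0) -EFinM -EFinD lte_fin ltrDl.
- exists (gamma * m) => z; rewrite /prox_obj.
  rewrite -[leLHS]adde0 EFinM; apply: leeD.
    by apply: lee_wpmul2l => //; rewrite lee_fin ltW.
  by rewrite lee_fin mulr_ge0// sqr_ge0.
- move=> z; have := gm z; rewrite /prox_obj; case: (g z) => [r| |] //=.
    rewrite -EFinM -EFinD lte_fin lee_fin => mr ha.
    have hyz : `|z| <= `|y| + `|y - z|.
      by have := ler_normB y (y - z); rewrite subKr.
    have : gamma * m <= gamma * r by rewrite ler_pM2l.
    have : `|y - z| <= `|y - z| ^+ 2 + 1 by have := sqr_ge0 (`|y - z| - 1); nra.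
    lra.
  by rewrite gt0_muley ?lte_fin.
Qed.

Lemma prox_fin_num y : g (prox gamma g y) \is a fin_num.
Proof.
have [gNy [z0 gz0]] := g_proper.
have := prox_minimizer y z0; have := gNy (prox gamma g y).
rewrite /prox_obj -(fineK gz0) -EFinM -EFinD.
by case: (g _) => // _; rewrite gt0_muley ?lte_fin.
Qed.

(** First-order optimality: compare the objective at p and at p + t (z - p), use convexity of g,
    divide by t and let t tend to 0. The term t/2 |z - p|^2 that survives the division is the
    vanishing error. *)
Lemma prox_variational y z : g z \is a fin_num ->
  let p := prox gamma g y in
  gamma * fine (g p) + ip (y - p) (z - p) <= gamma * fine (g z).
Proof.
move=> gz; set p := prox gamma g y; cbv zeta.
have gp : g p \is a fin_num by exact: prox_fin_num.
rewrite -subr_le0.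
apply: (@le0_of_forall_small R _ (2^-1 * `|z - p| ^+ 2)) => [|t /andP[t0 t1]].
  by rewrite mulr_ge0// sqr_ge0.
have t01 : 0 <= t <= 1 by rewrite !ltW.
have ipZ : ip (y - p) (t *: (z - p)) = t * ip (y - p) (z - p).
  by rewrite linearZr_LR.
have := prox_minimizer y (t *: z + (1 - t) *: p).
have := g_convex t z p t01.
have := (g_proper.1 (t *: z + (1 - t) *: p)).
rewrite /prox_obj -/p -(fineK gz) -(fineK gp) -!EFinM -!EFinD.
case: (g _) => // r _; rewrite -EFinM -EFinD !lee_fin.
rewrite (@convex_combE R E) opprD addrA (sqr_normB ip norm_ip (y - p)) ipZ normrZ.
rewrite ger0_norm ?(ltW t0)//.
move=> gr hmin.
have gr' := ler_wpM2l (ltW gamma_gt0) gr.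
rewrite -(ler_pM2l t0); lra.
Qed.

End proximal.

(** * Convergence from a Lyapunov inequality *)

Section lyapunov.
Context {R : realType} {E : normedVectType R} (ip : {dot E for idfun}).
Context (norm_ip : forall u : E, `|u| = Num.sqrt (ip u u)).

Lemma lyapunov_cvg (J : E -> \bar R) (x : nat -> E) (j : nat -> R) (r m K c : R) :
  lower_semicontinuous J -> (forall n, J (x n) = (j n)%:E) ->
  (forall n, `|x n| <= r) -> (forall z, (m%:E <= J z)%E) ->
  0 <= K -> 0 < c -> nonincreasing_seq j ->
  (forall z jz, J z = jz%:E -> forall n,
    `|x n.+1 - z| ^+ 2 + K * j n.+1 + c * (j n.+1 - jz) <=
    `|x n - z| ^+ 2 + K * j n) ->
  exists2 xstar, minimizers J xstar & x n @[n --> \oo] --> xstar.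
Proof.
move=> Jlsc Jx xr mJ K0 c0 jdec step.
have mj n : m <= j n by rewrite -lee_fin -Jx.
have jcvg : cvgn j.
  by apply: nonincreasing_is_cvgn => //; exists m => _ [n _ <-].
pose l := limn j.
have lj n : l <= j n by exact: nonincreasing_cvgn_ge.
(* If J z = jz < l, every step lowers D by at least the fixed amount c (l - jz) > 0, although D
   stays above K l. *)
have Jl z : (l%:E <= J z)%E.
  case Jz : (J z) (mJ z) => [jz| |//] _; rewrite ?leey// lee_fin leNgt.
  apply/negP => jzl.
  pose D n := `|x n - z| ^+ 2 + K * j n.
  have Ddec n : D n <= D 0 - (c * (l - jz)) *+ n.
    elim: n => [|n IHn]; first by rewrite subr0.
    have := step _ _ Jz n; rewrite -/(D n) -/(D n.+1) mulrSr.
    have := lj n.+1; rewrite -(ler_pM2l c0) => h1 h2; lra.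
  have Dge n : K * l <= D n.
    by rewrite /D -[leLHS]add0r lerD ?sqr_ge0// ler_wpM2l.
  have d0 : 0 < c * (l - jz) by rewrite mulr_gt0// subr_gt0.
  have := Num.Theory.archi_boundP (x := (D 0 - K * l) / (c * (l - jz))).
  rewrite divr_ge0 ?subr_ge0// ?(ltW d0)// => /(_ isT).
  set N := Num.bound _; rewrite ltr_pdivrMr// mulr_natl.
  have := Ddec N; have := Dge N; lra.
have [z xz] : exists z, cluster (x @ \oo) z.
  by apply: (@compact_seq_cluster _ _ ip norm_ip x r); exact: nearW.
have Jz : J z = l%:E.
  apply/eqP; rewrite eq_le Jl andbT; apply/lee_addgt0Pr => e e0.
  rewrite -EFinD; apply: (lsc_cluster_le J (x @ \oo) _ _ z Jlsc _ xz).
  have : \forall n \near \oo, j n < l + e.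
    by apply: (@cvgr_lt _ _ _ _ _ _ jcvg); rewrite ltrDl.
  by rewrite near_simpl; apply: filterS => n jn /=; rewrite Jx lee_fin ltW.
exists z; first by move=> w; rewrite Jz.
(* Shifting by l = J z makes the second term nonnegative and convergent to 0, so D is small as soon
   as one late iterate is close to z. *)
pose D n := `|x n - z| ^+ 2 + K * (j n - l).
have Ddec : nonincreasing_seq D.
  apply/nonincreasing_seqP => n; rewrite /D.
  have := step _ _ Jz n; have := lj n.+1; rewrite -subr_ge0 -(pmulr_rge0 _ c0).
  lra.
apply/cvgrPdist_lt => e e0.
(* The budget is (e/2)^2 for the distance and e^2/2 for the other term: together 3/4 e^2 < e^2. *)
have e20 : 0 < e ^+ 2 / 2 by rewrite divr_gt0// exprn_gt0.
have Kj : K * (j n - l) @[n --> \oo] --> 0.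
  rewrite -(mulr0 K) -(subrr l); apply: cvgM; first exact: cvg_cst.
  by apply: cvgB => //; exact: cvg_cst.
have [N _ KN] := @cvgr_lt _ _ _ _ _ _ Kj _ e20.
have : nbhs z [set y | `|z - y| < e / 2].
  by apply/nbhs_normP; exists (e / 2) => //=; rewrite divr_gt0.
have xN : (x @ \oo) [set x n | n in [set n | (N <= n)%N]].
  by exists N => // n Nn /=; exists n.
move=> /(xz _ _ xN)[_ [[n /= Nn <-] zn]].
exists n => // k /= nk.
rewrite -(@ltr_pXn2r _ 2)// ?nnegrE ?(ltW e0)// distrC.
have Kk : 0 <= K * (j k - l) by rewrite mulr_ge0// subr_ge0.
have := Ddec _ _ nk; rewrite /D.
have := KN n Nn => /= Kn.
have : `|x n - z| ^+ 2 < (e / 2) ^+ 2.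
  by rewrite ltr_pXn2r ?nnegrE ?divr_ge0// ?(ltW e0)// distrC.
nra.
Qed.

End lyapunov.

(** * The forward-backward iteration *)

Lemma coercive_sublevel_bounded (R : realType) (E : normedVectType R)
    (g : E -> \bar R) (a : R) : coercive g ->
  exists r, forall z, (g z <= a%:E)%E -> `|z| <= r.
Proof.
move=> /cvgey_gt/(_ a)[r _ rg]; exists r => z gza.
by rewrite leNgt; apply/negP => /rg /=; rewrite ltNge gza.
Qed.

Theorem theorem8 (R : realType) (E : normedVectType R)
  (ip : {dot E for idfun})
  (norm_ip : forall u : E, `|u| = Num.sqrt (ip u u))
  (f : E -> R) (g : E -> \bar R) (L gamma : R) (x0 : E) (x : nat -> E)
  (f_convex : convex_function (E := E) setT f)
  (f_coercive : coercive (EFin \o f))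
  (f_lsc : lower_semicontinuous (EFin \o f))
  (f_bounded : bounded_below (EFin \o f))
  (f_diff : forall u : E, differentiable f u)
  (L_gt0 : 0 < L)
  (f_smooth : L.-lipschitz (grad ip f))
  (g_proper : eproper g)
  (g_convex : econvex g)
  (g_coercive : coercive g)
  (g_lsc : lower_semicontinuous g)
  (g_bounded : bounded_below g)
  (gamma_gt0 : 0 < gamma) (gamma_lt : gamma < 2 / L)
  (x_init : x 0%N = x0)
  (x_step : forall n, x n.+1 = prox gamma g (x n - gamma *: grad ip f (x n))) :
  exists2 xstar : E,
    minimizers (fun z => (f z)%:E + g z)%E xstar & x n @[n --> \oo] --> xstar.
Proof.
pose J z := ((f z)%:E + g z)%E.
have [mf f_ge] := f_bounded; have [mg g_ge] := g_bounded.
pose y n := x n.+1; pose j n := f (y n) + fine (g (y n)).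
have gy n : g (y n) \is a fin_num by rewrite /y x_step; exact: prox_fin_num.
have Jy n : J (y n) = (j n)%:E by rewrite /J /j EFinD fineK.
have J_lsc : lower_semicontinuous J.
  rewrite (_ : J = fun z => 1%:E * g z + (f z)%:E)%E.
    apply: lower_semicontinuousD_continuous => // z.
    exact: differentiable_continuous.
  by apply/funext => z; rewrite mul1e addeC.
have gL : 0 < 1 - gamma * L / 2 by move: gamma_lt; rewrite ltr_pdivlMr//; lra.
pose K := gamma / (1 - gamma * L / 2).
(* Used at z = y n (bounding the step length by the decrease of J) and at      *)
(* arbitrary z (distance estimate).                                            *)
have prox_step n z : g z \is a fin_num ->
    gamma * j n.+1 + ip (y n - y n.+1) (z - y n.+1) <=
    gamma * (f z + fine (g z)) + gamma * L / 2 * `|y n.+1 - y n| ^+ 2.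
  move=> gz; have := prox_variational ip norm_ip gamma g gamma_gt0 g_proper g_convex
    g_lsc g_bounded (y n - gamma *: grad ip f (y n)) z gz.
  rewrite -x_step -/(y n.+1) /=.
  set G := grad ip f (y n); set p := y n.+1 => hprox.
  have hdesc := descent ip norm_ip f f_diff L f_smooth (y n) p.
  have hgrad := grad_le ip f f_diff f_convex (y n) z.
  rewrite -/G in hdesc hgrad.
  (* Splitting z - p at y n produces exactly the gradient terms of [hgrad] and [hdesc], which cancel
     in the sum. *)
  have E1 : ip (y n - gamma *: G - p) (z - p) =
      ip (y n - p) (z - p) - gamma * ip G (z - y n) + gamma * ip G (p - y n).
    rewrite addrAC linearBl /= linearZl_LR.
    have -> : z - p = (z - y n) - (p - y n) by rewrite opprB addrA subrK.
    by rewrite (linearB (ip G) (z - y n) (p - y n)) /=; ring.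
  have := ler_wpM2l (ltW gamma_gt0) hdesc.
  have := ler_wpM2l (ltW gamma_gt0) hgrad.
  rewrite /j -/p; lra.
have decr n : `|y n.+1 - y n| ^+ 2 <= K * (j n - j n.+1).
  have := prox_step n _ (gy n); rewrite (ipvv ip norm_ip) (distrC (y n)) -/(j n) => h.
  rewrite /K mulrAC ler_pdivlMr//; lra.
have jdec : nonincreasing_seq j.
  apply/nonincreasing_seqP => n; rewrite -subr_ge0.
  rewrite -(pmulr_rge0 _ (divr_gt0 gamma_gt0 gL)).
  by apply: le_trans (decr n); rewrite sqr_ge0.
have [r yr] : exists r, forall n, `|y n| <= r.
  (* Since j decreases and f >= mf, g (y n) = j n - f (y n) <= j 0 - mf. *)
  have [r gr] := coercive_sublevel_bounded _ _ g (j 0 - mf) g_coercive.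
  exists r => n; apply: gr; rewrite -(fineK (gy n)) lee_fin.
  have := jdec 0 n isT; have := f_ge (y n); rewrite /j /= lee_fin; lra.
suff [z Jz yz] : exists2 z, minimizers J z & y n @[n --> \oo] --> z.
  by exists z => //; rewrite -cvg_shiftS.
apply: (@lyapunov_cvg _ _ ip norm_ip J y j r (mf + mg) K (2 * gamma)) => //.
- by move=> z; rewrite EFinD leeD// f_ge.
- by rewrite divr_ge0// ltW.
- by rewrite mulr_gt0.
- move=> z jz Jz n.
  have gz : g z \is a fin_num.
    by move: Jz (g_proper.1 z); rewrite /J; case: (g z).
  have jzE : jz = f z + fine (g z) by apply: EFin_inj; rewrite -Jz EFinD fineK.
  have := prox_step n z gz; rewrite -jzE.
  have := decr n; have := sqr_ge0 `|y n.+1 - y n|.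
  (* The three-point identity turns the inner product of [prox_step] into squared distances. *)
  have : `|y n - z| ^+ 2 = `|y n - y n.+1| ^+ 2
       - 2 * ip (y n - y n.+1) (z - y n.+1) + `|z - y n.+1| ^+ 2.
    by rewrite -(sqr_normB ip norm_ip) opprB addrA subrK.
  rewrite (distrC (y n) (y n.+1)) (distrC z (y n.+1)).
  move: (`|y n.+1 - y n| ^+ 2) gL => S gL.
  move=> -> S0 KS h.
  (* Hence the error (gamma L - 1) S is at most S, which [decr] bounds by K (j n - j n.+1). *)
  have : gamma * L * S <= 2 * S by rewrite ler_wpM2r//; lra.
  lra.
Qed.
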